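(* Let $M$ be a finite von Neumann algebra with faithful normal tracial state $\tau$, let $(\Phi_t)_{t\ge 0}$ be a quantum Markov semi-group on $(M,\tau)$ with generator $\Delta$, and let $\mathcal{A}\subseteq M$ be a $\ast$-subalgebra satisfying the standing assumption in the context, with norm closure $A$. Let $n\ge1$. The map $$\partial_n:\mathcal{A}^{\otimes n}\to L_2(M)_{\nabla^{(n)}},\qquad a_1\otimes\dots\otimes a_n\mapsto a_1\otimes_\nabla\dots\otimes_\nabla a_n\otimes_\nabla\Omega_\tau$$ defines a Hochschild $n$-cocycle, i.e. an element of $C^n(\mathcal{A},L_2(M)_{\nabla^{(n)}})$.
   Context: Quantum Markov semi-groups. $L_2(M)=L_2(M,\tau)$ and $\Omega_\tau\in L_2(M)$ is the cyclic vector given by $1\in M$. A quantum Markov semi-group on $(M,\tau)$ is a semi-group $(\Phi_t)_{t\ge0}$ of unital completely positive maps $M\to M$ with $\tau\circ\Phi_t=\tau$ and $\tau(\Phi_t(x)y)=\tau(x\Phi_t(y))$ for $x,y\in M$, such that $t\mapsto\Phi_t(x)$ is strongly continuous for every $x\in M$. Its generator is the positive self-adjoint operator $\Delta\ge0$ on $L_2(M)$ with $\exp(-t\Delta)(x\Omega_\tau)=\Phi_t(x)\Omega_\tau$. Standing assumption. $\mathcal{A}\subseteq M$ is a $\sigma$-weakly dense $\ast$-subalgebra with $\mathcal{A}\Omega_\tau\subseteq\mathrm{Dom}(\Delta)$, $\Delta(\mathcal{A}\Omega_\tau)\subseteq\mathcal{A}\Omega_\tau$ (write $\Delta(a)\in\mathcal{A}$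 for the element with $\Delta(a)\Omega_\tau=\Delta(a\Omega_\tau)$), and $t\mapsto\Phi_t(a)$ is norm continuous for every $a\in\mathcal{A}$. Gradient tensor product. An $A$-$A$ bimodule is a Hilbert space with commuting $\ast$-homomorphisms of $A$ and $A^{\mathrm{op}}$ (left and right actions); $L_2(M)$ is one by left and right multiplication. Put $\Gamma(x,y)=\frac12\big(\Delta(y)^\ast x+y^\ast\Delta(x)-\Delta(y^\ast x)\big)$ for $x,y\in\mathcal{A}$. For an $A$-$A$ bimodule $H$, $H_\nabla$ is the Hilbert space obtained from the algebraic tensor product $\mathcal{A}\otimes_{\mathrm{alg}}H$ with the degenerate inner product $\langle x\otimes\xi,y\otimes\eta\rangle=\langle\Gamma(x,y)\xi,\eta\rangle$ by quotienting out the degenerate part and completing; $a\otimes_\nabla\xi$ is the class of $a\otimes\xi$. It is an $A$-$A$ bimodule via $x\cdot(y\otimes_\nabla\xi)=xy\otimes_\nabla\xi-x\otimes_\nabla y\xi$ and $(y\otimes_\nabla\xi)\cdot x=y\otimes_\nabla\xi x$ for $x,y\in\mathcal{A}$ (these actions extend to $A$). $H_{\nabla^{(n)}}$ is the result of applying $H\mapsto H_\nabla$ $n$ times. Hochschild cocycles. For an $\mathcal{A}$-$\mathcal{A}$ bimodule $K$ and a linear map $f:\mathcal{A}^{\otimes n}\to K$, $(d_nf)(a_1\otimes\dots\otimes a_{n+1})=a_1f(a_2\otimes\dots\otimes a_{n+1})+\sum_{k=1}^n(-1)^kf(a_1\otimes\dots\otimes a_ka_{k+1}\otimes\dots\otimes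 a_{n+1})+(-1)^{n+1}f(a_1\otimes\dots\otimes a_n)a_{n+1}$. $C^n(\mathcal{A},K)$ is the set of linear $f:\mathcal{A}^{\otimes n}\to K$ with $d_nf=0$. *)

(* Defs.v *)
From HB Require Import structures.
From mathcomp Require Import all_boot all_order all_algebra sesquilinear.
From mathcomp Require Import all_classical all_reals all_analysis.
From mathcomp Require Import complex.
Set Implicit Arguments.
Unset Strict Implicit.
Unset Printing Implicit Defensive.
Import Order.TTheory GRing.Theory Num.Theory numFieldNormedType.Exports.
Local Open Scope classical_set_scope.
Local Open Scope ring_scope.
Local Open Scope complex_scope.

(* The inner product is linear in the first variable. *)
Record hilbert (R : realType) := Hilbert {
  hilbert_sort :> completeNormedModType R[i];
  inner : {dot hilbert_sort for (@Num.conj R[i])};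
  inner_norm : forall x, inner x x = `|x| ^+ 2 }.

Notation "<| x , y |>" := (inner _ x y) (at level 0, x, y at level 99,
  format "<| x ,  y |>") : ring_scope.

Section BoundedOperators.
Variables (R : realType) (H : hilbert R).

Definition bounded_linear : {pred H -> H} := fun T =>
  `[< linear T /\ exists k : R, forall x, `|T x| <= k%:C * `|x| >].

Lemma bounded_linear_submod : submod_closed bounded_linear.
Proof.
split=> [|c S T /asboolP[lS [k hk]] /asboolP[lT [l hl]]]; apply/asboolP; split.
- by move=> a x y; rewrite /GRing.zero /= scaler0 addr0.
- by exists 0 => x; rewrite (_ : 0 x = 0)// normr0 mul0r.
- move=> a x y; have E z : (c *: S + T) z = c *: S z + T z by [].
  by rewrite !E lS lT !scalerDr !scalerA [c * a]mulrC addrACA.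
exists (complex.Re `|c| * k + l) => x.
rewrite rmorphD rmorphM /= mulrDl (le_trans (ler_normD _ _))// lerD//.
have -> : (complex.Re `|c|)%:C = `|c| by apply/RRe_real/normr_real.
by rewrite normrZ -mulrA ler_wpM2l.
Qed.

HB.instance Definition _ :=
  GRing.isSubmodClosed.Build R[i] (H -> H) bounded_linear bounded_linear_submod.

Record bop := Bop { bop_fun :> H -> H; bop_valP : bop_fun \in bounded_linear }.

HB.instance Definition _ := [isSub for bop_fun].
HB.instance Definition _ := [Choice of bop by <:].
HB.instance Definition _ := [SubChoice_isSubLmodule of bop by <:].

Lemma bopP (S T : bop) : (forall x, S x = T x) -> S = T.
Proof. by move=> ST; apply/val_inj/funext. Qed.

Lemma bop_linear (T : bop) : linear T.
Proof. by case: T => T /= /asboolP[]. Qed.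

Lemma bop_id_subproof : (@id H) \in bounded_linear.
Proof. by apply/asboolP; split=> //; exists 1 => x; rewrite mul1r. Qed.

Lemma bop_comp_subproof (S T : bop) : (S \o T) \in bounded_linear.
Proof.
case: S T => [S /asboolP[lS [k hk]]] [T /asboolP[lT [l hl]]] /=.
apply/asboolP; split=> [a x y|]; first by rewrite /= lT lS.
exists (`|k| * l) => x /=; apply: (le_trans (hk _)).
apply: (@le_trans _ _ (`|k|%:C * `|T x|)).
  by rewrite ler_wpM2r// lecR ler_norm.
by rewrite rmorphM /= -mulrA ler_wpM2l// lecR.
Qed.

Definition bop_id := Bop bop_id_subproof.
Definition bop_comp S T := Bop (bop_comp_subproof S T).

Fact bop_compA : associative bop_comp. Proof. by move=> *; apply/bopP. Qed.
Fact bop_comp1l : left_id bop_id bop_comp. Proof. by move=> ?; apply/bopP. Qed.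
Fact bop_comp1r : right_id bop_id bop_comp. Proof. by move=> ?; apply/bopP. Qed.
Fact bop_compDl : left_distributive bop_comp +%R.
Proof. by move=> S T U; apply/bopP. Qed.
Fact bop_compDr : right_distributive bop_comp +%R.
Proof.
move=> S T U; apply/bopP => x /=.
by have := bop_linear S 1 (T x) (U x); rewrite !scale1r.
Qed.

HB.instance Definition _ := GRing.Zmodule_isPzRing.Build bop
  bop_compA bop_comp1l bop_comp1r bop_compDl bop_compDr.

(* The adjoint exists, and is unique, by the Riesz representation theorem. *)
Definition adjoint (T : bop) : bop :=
  xget 0 [set S : bop | forall x y, <| T x, y |> = <| x, S y |>].

(* The operator norm. *)
Definition opnorm (T : bop) : R :=
  inf [set k : R | 0 <= k /\ forall x, `|T x| <= k%:C * `|x|].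

Definition positive_op (T : bop) : Prop := forall x, 0 <= <| T x, x |>.
Definition op_le (S T : bop) : Prop := positive_op (T - S).

(* Positivity of a matrix of operators, acting on the direct sum of copies
   of [H]. *)
Definition positive_opmx n (X : 'I_n -> 'I_n -> bop) : Prop :=
  forall x : 'I_n -> H, 0 <= \sum_i \sum_j <| X i j (x j), x i |>.

Definition commutant (S : set bop) : set bop :=
  [set T | forall s, S s -> T * s = s * T].

Definition von_neumann_algebra (M : set bop) : Prop :=
  (forall x, M x -> M (adjoint x)) /\ commutant (commutant M) = M.

Definition finite_algebra (M : set bop) : Prop :=
  forall v, M v -> adjoint v * v = 1 -> v * adjoint v = 1.

Definition linear_on (V : lmodType R[i]) (M : set bop) (f : bop -> V) : Prop :=
  forall a x y, M x -> M y -> f (a *: x + y) = a *: f x + f y.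

Definition op_lub (M D : set bop) (s : bop) : Prop :=
  [/\ M s, forall d, D d -> op_le d s
    & forall u, M u -> (forall d, D d -> op_le d u) -> op_le s u].

(* Normality: suprema of bounded upward directed sets in the positive cone are
   preserved. *)
Definition normal_on (M : set bop) (tau : bop -> R[i]) : Prop :=
  forall (D : set bop) (s : bop),
    (forall d, D d -> M d /\ positive_op d) -> D !=set0 ->
    (forall d e, D d -> D e -> exists f, [/\ D f, op_le d f & op_le e f]) ->
    op_lub M D s ->
  forall e : R[i], 0 < e -> exists2 d, D d & tau s < tau d + e.

Record faithful_normal_trace (M : set bop) (tau : bop -> R[i]) : Prop := {
  trace_linear : @linear_on R[i]^o M tau;
  trace_ge0 : forall x, M x -> positive_op x -> 0 <= tau x;
  trace1 : tau 1 = 1;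
  traceC : forall x y, M x -> M y -> tau (x * y) = tau (y * x);
  trace_faithful : forall x, M x -> positive_op x -> tau x = 0 -> x = 0;
  trace_normal : normal_on M tau }.

Definition square_summable (xi : nat -> H) : Prop :=
  cvgn (series (fun k => `|xi k| ^+ 2 : R[i]^o)).

(* The functionals defining the sigma-weak topology. *)
Definition sigma_weak_functional (xi eta : nat -> H) (T : bop) : R[i] :=
  limn (series (fun k => <| T (xi k), eta k |> : R[i]^o)).

Definition sigma_weakly_dense (A M : set bop) : Prop :=
  forall x, M x -> forall m (xi eta : 'I_m -> nat -> H),
    (forall i, square_summable (xi i) /\ square_summable (eta i)) ->
  forall e : R[i], 0 < e ->
  exists2 a, A a & forall i,
    `|sigma_weak_functional (xi i) (eta i) (x - a)| < e.

Definition norm_closure (A : set bop) : set bop :=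
  [set x | forall e : R, 0 < e -> exists2 a, A a & opnorm (x - a) < e].

(* Not required to be unital. *)
Record star_subalgebra := StarSubalgebra {
  star_carrier :> {pred bop};
  star_submod : submod_closed star_carrier;
  star_mul : {in star_carrier &, forall x y, x * y \in star_carrier};
  star_adj : {in star_carrier, forall x, adjoint x \in star_carrier} }.

End BoundedOperators.

Notation "''B' ( H )" := (bop H) (format "''B' ( H )") : type_scope.

HB.instance Definition _ (R : realType) (H : hilbert R)
    (A : star_subalgebra H) :=
  GRing.isSubmodClosed.Build R[i] 'B(H) (star_carrier A) (@star_submod _ _ A).

Section StarSubalgebra.
Variables (R : realType) (H : hilbert R) (A : star_subalgebra H).

Record elt := Elt { elt_val :> 'B(H); elt_valP : elt_val \in A }.

HB.instance Definition _ := [isSub for elt_val].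
HB.instance Definition _ := [Choice of elt by <:].
HB.instance Definition _ := [SubChoice_isSubLmodule of elt by <:].

Definition elt_mul (a b : elt) : elt := Elt (star_mul (elt_valP a) (elt_valP b)).
Definition elt_adj (a : elt) : elt := Elt (star_adj (elt_valP a)).

Definition star_set : set 'B(H) := [set x | x \in A].

End StarSubalgebra.

Section QMS.
Variables (R : realType) (H : hilbert R).
Implicit Types M : set 'B(H).

Definition completely_positive M (f : 'B(H) -> 'B(H)) : Prop :=
  forall n (X : 'I_n -> 'I_n -> 'B(H)), (forall i j, M (X i j)) ->
    positive_opmx X -> positive_opmx (fun i j => f (X i j)).

Record quantum_markov M (tau : 'B(H) -> R[i]) (Phi : R -> 'B(H) -> 'B(H)) :
    Prop := {
  qms_stable : forall t x, 0 <= t -> M x -> M (Phi t x);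
  qms_linear : forall t, 0 <= t -> linear_on M (Phi t);
  qms_unital : forall t, 0 <= t -> Phi t 1 = 1;
  qms_cp : forall t, 0 <= t -> completely_positive M (Phi t);
  qms_0 : forall x, M x -> Phi 0 x = x;
  qms_D : forall s t x, 0 <= s -> 0 <= t -> M x ->
    Phi (s + t) x = Phi s (Phi t x);
  qms_trace : forall t x, 0 <= t -> M x -> tau (Phi t x) = tau x;
  qms_sym : forall t x y, 0 <= t -> M x -> M y ->
    tau (Phi t x * y) = tau (x * Phi t y);
  qms_continuous : forall x, M x -> forall xi : H,
    {within `[0, +oo[%classic, continuous (fun t => Phi t x xi)} }.

End QMS.

Section Unbounded.
Variables (R : realType) (K : hilbert R).

Record operator := Operator { dom : set K; oper :> K -> K }.

Record self_adjoint (D : operator) : Prop := {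
  sa_dom : dom D 0 /\ forall a x y, dom D x -> dom D y -> dom D (a *: x + y);
  sa_dense : dense (dom D);
  sa_linear : forall a x y, dom D x -> dom D y ->
    D (a *: x + y) = a *: D x + D y;
  sa_symmetric : forall x y, dom D x -> dom D y -> <| D x, y |> = <| x, D y |>;
  sa_maximal : forall y z, (forall x, dom D x -> <| D x, y |> = <| x, z |>) ->
    dom D y /\ D y = z }.

Definition positive_operator (D : operator) : Prop :=
  forall x, dom D x -> 0 <= <| D x, x |>.

(* [E] is the projection-valued measure of [D], and [mu x] is the scalar measure
   [B |-> <| E B x, x |>].  Orthogonality of [E B] and [E B'] for disjoint [B],
   [B'] and countable additivity of [E] follow from these fields. *)
Record spectral_measure (D : operator) (E : set R -> 'B(K))
    (mu : K -> {measure set (measurableTypeR R) -> \bar R}) : Prop := {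
  spec_proj : forall B : set (measurableTypeR R), measurable B ->
    E B * E B = E B /\ adjoint (E B) = E B;
  spec_total : E setT = 1;
  spec_mu : forall x (B : set (measurableTypeR R)), measurable B ->
    <| E B x, x |> = (fine (mu x B))%:C /\ (mu x B < +oo)%E;
  spec_dom : forall x, dom D x <-> (\int[mu x]_l (l ^+ 2)%:E < +oo)%E;
  spec_op : forall x, dom D x -> <| D x, x |> = (\int[mu x]_l l)%:C }.

(* [T] is the operator [f(D)] of the bounded Borel functional calculus. *)
Definition functional_calculus (D : operator) (f : R -> R) (T : 'B(K)) : Prop :=
  exists E mu, @spectral_measure D E mu /\
    forall x, <| T x, x |> = (\int[mu x]_l f l)%:C.

Definition is_exp (D : operator) (t : R) (T : 'B(K)) : Prop :=
  functional_calculus D (fun l => expR (- (t * l))) T.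

End Unbounded.

Section Bimodules.
Variables (R : realType) (H : hilbert R).

(* The actions are only meaningful on [A]. *)
Record hbimodule (A : set 'B(H)) := HBimodule {
  hbimodule_sort :> hilbert R;
  lact : 'B(H) -> 'B(hbimodule_sort);
  ract : 'B(H) -> 'B(hbimodule_sort);
  lact_linear : linear_on A lact;
  lactM : forall a b, A a -> A b -> lact (a * b) = lact a * lact b;
  lact_adj : forall a, A a -> lact (adjoint a) = adjoint (lact a);
  ract_linear : linear_on A ract;
  ractM : forall a b, A a -> A b -> ract (a * b) = ract b * ract a;
  ract_adj : forall a, A a -> ract (adjoint a) = adjoint (ract a);
  lract_comm : forall a b, A a -> A b -> lact a * ract b = ract b * lact a }.

(* [gns x] is the vector [x Omega_tau]; [L] is the completion of [M] for the
   inner product [tau (y^* x)]. *)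
Record is_L2 (M : set 'B(H)) (tau : 'B(H) -> R[i]) (A : set 'B(H))
    (L : hbimodule A) (gns : 'B(H) -> L) : Prop := {
  gns_linear : linear_on M gns;
  gns_inner : forall x y, M x -> M y -> <| gns x, gns y |> = tau (adjoint y * x);
  gns_dense : dense (gns @` M);
  gns_lact : forall a x, A a -> M x -> lact L a (gns x) = gns (a * x);
  gns_ract : forall a x, A a -> M x -> ract L a (gns x) = gns (x * a) }.

Definition is_generator (M : set 'B(H)) (Phi : R -> 'B(H) -> 'B(H))
    (L : hilbert R) (gns : 'B(H) -> L) (D : operator L) : Prop :=
  [/\ self_adjoint D, positive_operator D
    & forall t, 0 <= t -> exists2 T, is_exp D t T &
        forall x, M x -> T (gns x) = gns (Phi t x)].

(* [delta] is the restriction of [D] to the algebra. *)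
Record standing_assumption (M : set 'B(H)) (Phi : R -> 'B(H) -> 'B(H))
    (L : hilbert R) (gns : 'B(H) -> L) (D : operator L)
    (A : star_subalgebra H) (delta : elt A -> elt A) : Prop := {
  std_sub : star_set A `<=` M;
  std_dense : sigma_weakly_dense (star_set A) M;
  std_dom : forall a : elt A, dom D (gns a);
  std_delta : forall a : elt A, gns (delta a) = D (gns a);
  std_continuous : forall (a : elt A) (t : R), 0 <= t ->
    opnorm (Phi s a - Phi t a)
      @[s --> within `[0, +oo[%classic (nbhs t)] --> (0 : R) }.

End Bimodules.

Section Tensor.
Variables (F : fieldType) (U V : lmodType F).

Notation forms := {bilinear U -> V -> F | *%R & *%R}.

(* The algebraic tensor product over a field, realized as the span of the
   evaluations [B |-> B u v] in the dual of the space of bilinear forms. *)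
Definition tensor_pred : {pred forms -> F^o} := fun t =>
  `[< exists n (u : 'I_n -> U) (v : 'I_n -> V),
        t = \sum_i (fun B : forms => B (u i) (v i) : F^o) >].

Lemma tensor_submod : submod_closed tensor_pred.
Proof.
split=> [|c s t /asboolP[m [u [v ->]]] /asboolP[n [u' [v' ->]]]].
  by apply/asboolP; exists 0, (fun=> 0), (fun=> 0); rewrite big_ord0.
apply/asboolP; exists (m + n)%N.
exists (fun i => match fintype.split i with inl j => c *: u j | inr j => u' j end).
exists (fun i => match fintype.split i with inl j => v j | inr j => v' j end).
rewrite big_split_ord scaler_sumr /=; congr (_ + _); apply: eq_bigr => i _.
  rewrite (unsplitK (inl i)); apply/funext => B /=.
  by rewrite linearZl_LR.
by rewrite (unsplitK (inr i)).
Qed.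

HB.instance Definition _ :=
  GRing.isSubmodClosed.Build F (forms -> F^o) tensor_pred tensor_submod.

Record tensor := Tensor {
  tensor_val :> forms -> F^o; tensor_valP : tensor_val \in tensor_pred }.

HB.instance Definition _ := [isSub for tensor_val].
HB.instance Definition _ := [Choice of tensor by <:].
HB.instance Definition _ := [SubChoice_isSubLmodule of tensor by <:].

Lemma pure_tensor_subproof (u : U) (v : V) :
  (fun B : forms => B u v : F^o) \in tensor_pred.
Proof.
by apply/asboolP; exists 1%N, (fun=> u), (fun=> v); rewrite big_ord1.
Qed.

Definition pure_tensor u v : tensor := Tensor (pure_tensor_subproof u v).

End Tensor.

Notation "u ⊗ v" := (pure_tensor u v) (at level 40, left associativity)
  : ring_scope.

(* The zeroth power is [F], so that the first one is [tensor U F]. *)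
Fixpoint tensor_power (F : fieldType) (U : lmodType F) n : lmodType F :=
  if n is n'.+1 then tensor U (tensor_power U n') else F^o.

Fixpoint pure_tensor_power (F : fieldType) (U : lmodType F) n :
    ('I_n -> U) -> tensor_power U n :=
  match n with
  | 0 => fun=> (1 : F^o)
  | n'.+1 => fun a =>
      pure_tensor (a ord0) (pure_tensor_power (fun i => a (lift ord0 i)))
  end.

Section Gradient.
Variables (R : realType) (H : hilbert R) (A : star_subalgebra H).
Variable delta : elt A -> elt A.

Notation Abar := (norm_closure (star_set A)).

Definition Gamma (x y : elt A) : elt A :=
  2^-1 *: (elt_mul (elt_adj (delta y)) x + elt_mul (elt_adj y) (delta x)
           - delta (elt_mul (elt_adj y) x)).

(* [q] is the map to the completed quotient: [K'] carries the degenerate inner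
   product through [q], whose range is dense.  This determines [K'], with its
   two actions, up to a unique unitary compatible with [q]. *)
Record is_gradient (K K' : hbimodule Abar)
    (q : {linear tensor (elt A : lmodType R[i]) K -> K'}) : Prop := {
  grad_inner : forall (x y : elt A) (xi eta : K),
    <| q (x ⊗ xi), q (y ⊗ eta) |> = <| lact K (Gamma x y) xi, eta |>;
  grad_dense : dense (range q);
  grad_lact : forall (x y : elt A) (xi : K),
    lact K' x (q (y ⊗ xi)) =
      q (elt_mul x y ⊗ xi) - q (x ⊗ lact K y xi);
  grad_ract : forall (x y : elt A) (xi : K),
    ract K' x (q (y ⊗ xi)) = q (y ⊗ ract K x xi) }.

Record gradient (K : hbimodule Abar) := Gradient {
  grad_sort :> hbimodule Abar;
  grad_class : {linear tensor (elt A : lmodType R[i]) K -> grad_sort};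
  gradP : is_gradient grad_class }.

Variable nabla : forall K : hbimodule Abar, gradient K.

Fixpoint iter_gradient n (K : hbimodule Abar) : hbimodule Abar :=
  if n is n'.+1 then nabla (iter_gradient n' K) else K.

(* a_1 ⊗_nabla ... ⊗_nabla a_n ⊗_nabla xi *)
Fixpoint iter_class n (K : hbimodule Abar) (xi : K) :
    ('I_n -> elt A) -> iter_gradient n K :=
  match n with
  | 0 => fun=> xi
  | n'.+1 => fun a => grad_class (nabla (iter_gradient n' K))
      (a ord0 ⊗ iter_class xi (fun i => a (lift ord0 i)))
  end.

End Gradient.

Section Hochschild.
Variables (R : realType) (H : hilbert R) (A : star_subalgebra H).
Variable K : hbimodule (norm_closure (star_set A)).
Variable n : nat.

(* (a_0, ..., a_k a_(k+1), ..., a_n) *)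
Definition contract (k : 'I_n) (a : 'I_n.+1 -> elt A) : 'I_n -> elt A := fun j =>
  if (j < k)%N then a (lift ord_max j)
  else if j == k then elt_mul (a (lift ord_max k)) (a (lift ord0 k))
  else a (lift ord0 j).

(* The value of [d_n f] at the pure tensor of [a]; these values determine the
   linear map [d_n f]. *)
Definition hochschild_d (f : tensor_power (elt A : lmodType R[i]) n -> K)
    (a : 'I_n.+1 -> elt A) : K :=
  lact K (a ord0) (f (pure_tensor_power (fun i => a (lift ord0 i))))
  + \sum_(k < n) (-1) ^+ k.+1 *: f (pure_tensor_power (contract k a))
  + (-1) ^+ n.+1 *:
      ract K (a ord_max) (f (pure_tensor_power (fun i => a (lift ord_max i)))).

Definition hochschild_cocycle (f : {linear tensor_power (elt A : lmodType R[i]) n -> K}) : Prop :=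
  forall a, hochschild_d f a = 0.

End Hochschild.

(* Main.v *)
(** The differential [hochschild_d] anticommutes with [a ⊗ _]: if
    [f (a_0 ⊗ t) = a_0 ⊗_nabla g t], then the Leibniz rule for the left action
    on [K_nabla] gives [(d f) (a_0, ..., a_(n+1)) = - a_0 ⊗_nabla (d g) (a_1, ..., a_(n+1))].
    Since [partial_n] arises in this way from [partial_(n-1)], everything
    reduces to [partial_0 = Omega_tau], which is a cocycle because
    [a Omega_tau = Omega_tau a]. *)

Require Import Defs.
From HB Require Import structures.
From mathcomp Require Import all_boot all_order all_algebra sesquilinear.
From mathcomp Require Import all_classical all_reals all_analysis.
From mathcomp Require Import complex.
Set Implicit Arguments.
Unset Strict Implicit.
Unset Printing Implicit Defensive.
Import Order.TTheory GRing.Theory Num.Theory numFieldNormedType.Exports.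
Local Open Scope classical_set_scope.
Local Open Scope ring_scope.
Local Open Scope complex_scope.

Section TensorMap.
Variables (F : fieldType) (U V W : lmodType F).

Lemma pure_tensor_linearr (u : U) : linear (fun v : V => u ⊗ v).
Proof.
by move=> c v v'; apply/val_inj/funext => B /=; rewrite linearPr.
Qed.

HB.instance Definition _ (u : U) :=
  GRing.isLinear.Build F V (tensor U V) _ (pure_tensor u)
    (pure_tensor_linearr u).

Variable g : {linear V -> W}.

(** A tensor is a functional on bilinear forms, so [id ⊗ g] is the transpose of this pullback.
    Independence of the representation as a sum of pure tensors is then automatic. *)
Definition form_pullback (B : {bilinear U -> W -> F | *%R & *%R}) :
  U -> V -> F := fun u v => B u (g v).

Lemma form_pullback_bilinear B :
  bilinear_for *%R *%R (form_pullback B).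
Proof.
split=> [v c u u'|u c v v']; rewrite /form_pullback.
  exact: linearPl.
by rewrite linearP linearPr.
Qed.

HB.instance Definition _ B :=
  bilinear_isBilinear.Build F U V F *%R *%R (form_pullback B)
    (form_pullback_bilinear B).

Lemma tensor_map_subproof (t : tensor U V) :
  (fun B => t (form_pullback B)) \in @tensor_pred F U W.
Proof.
case: t => t /= /asboolP[n [u [v ->]]]; apply/asboolP.
exists n, u, (g \o v); apply/funext => B.
by rewrite !fct_sumE.
Qed.

Definition tensor_map (t : tensor U V) : tensor U W :=
  Tensor (tensor_map_subproof t).

Lemma tensor_map_linear : linear tensor_map.
Proof. by move=> c s t; apply/val_inj/funext. Qed.

HB.instance Definition _ :=
  GRing.isLinear.Build F (tensor U V) (tensor U W) _ tensor_map
    tensor_map_linear.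

Lemma tensor_map_pure u v : tensor_map (u ⊗ v) = u ⊗ g v.
Proof. exact/val_inj/funext. Qed.

End TensorMap.

Section NormClosure.
Variables (R : realType) (H : hilbert R).

Lemma opnorm0 : opnorm (0 : 'B(H)) = 0.
Proof.
apply/le_anti/andP; split.
  apply: ge_inf; first by exists 0 => k [].
  by split=> // x; rewrite mul0r (_ : (0 : 'B(H)) x = 0)// normr0.
apply: lb_le_inf; last by move=> k [].
by exists 0; split=> // x; rewrite mul0r (_ : (0 : 'B(H)) x = 0)// normr0.
Qed.

(** The axioms of [hbimodule] and [is_L2] control the actions on the norm closure, so elements of
    the algebra must be placed there; each approximates itself. *)
Lemma sub_norm_closure (S : set 'B(H)) : S `<=` norm_closure S.
Proof. by move=> x Sx e e0; exists x; rewrite // subrr opnorm0. Qed.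

(** The identity lies in every commutant, and [M] is its own bicommutant. *)
Lemma von_neumann_algebra1 (M : set 'B(H)) : von_neumann_algebra M -> M 1.
Proof. by case=> _ <- s _; rewrite mul1r mulr1. Qed.

End NormClosure.

Section Contract.
Variables (R : realType) (H : hilbert R) (A : star_subalgebra H) (n : nat).

Lemma lift_max0 : lift ord_max (@ord0 n) = ord0.
Proof. exact/val_inj. Qed.

Lemma lift0_max : lift ord0 (@ord_max n) = ord_max.
Proof. exact/val_inj. Qed.

Lemma lift_max_lift0 (i : 'I_n) :
  lift ord_max (lift ord0 i) = lift ord0 (lift ord_max i).
Proof. by apply/ord_inj; rewrite lift_max !lift0 lift_max. Qed.

Variable a : 'I_n.+2 -> elt A.

Lemma contract00 :
  Defs.contract ord0 a ord0 = elt_mul (a ord0) (a (lift ord0 ord0)).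
Proof. by rewrite /Defs.contract /= lift_max0. Qed.

Lemma contract_lift0 (k : 'I_n) : Defs.contract (lift ord0 k) a ord0 = a ord0.
Proof. by rewrite /Defs.contract /= lift_max0. Qed.

End Contract.

(** A product formed away from entry 0 does not touch that entry, so on the tail it is a product one
    position earlier. *)
Lemma contract_lift (R : realType) (H : hilbert R) (A : star_subalgebra H)
    (n : nat) (a : 'I_n.+2 -> elt A) (k : 'I_n) :
  (fun i => Defs.contract (lift ord0 k) a (lift ord0 i)) =
  Defs.contract k (fun j => a (lift ord0 j)).
Proof.
apply/funext => i; rewrite /Defs.contract (inj_eq lift_inj) !lift_max_lift0.
by rewrite !lift0 ltnS.
Qed.

Section GradientCocycle.
Variables (R : realType) (H : hilbert R) (A : star_subalgebra H).
Variable delta : elt A -> elt A.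
Notation Abar := (norm_closure (star_set A)).

Section Suspension.
Variables (K : hbimodule Abar) (K' : gradient delta K) (n : nat).
Variable g : {linear tensor_power (elt A : lmodType R[i]) n -> K}.

Definition suspension : tensor_power (elt A : lmodType R[i]) n.+1 -> K' :=
  grad_class K' \o tensor_map g.

HB.instance Definition _ := GRing.Linear.on suspension.

Lemma suspension_pure (a : 'I_n.+1 -> elt A) :
  suspension (pure_tensor_power a) =
  grad_class K' (a ord0 ⊗ g (pure_tensor_power (fun i => a (lift ord0 i)))).
Proof. by rewrite /suspension /= tensor_map_pure. Qed.

End Suspension.

Lemma hochschild_d_suspension (K : hbimodule Abar) (K' : gradient delta K)
    (n : nat) (g : {linear tensor_power (elt A : lmodType R[i]) n -> K})
    (a : 'I_n.+2 -> elt A) :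
  hochschild_d (suspension K' g) a =
  - grad_class K' (a ord0 ⊗ hochschild_d g (fun i => a (lift ord0 i))).
Proof.
rewrite /hochschild_d !suspension_pure.
(* The Leibniz rule splits the left action into [a_0 a_1 ⊗ ...] and [- a_0 ⊗ a_1 ...]; the latter is
   the leading term of the right-hand side. *)
rewrite (grad_lact (gradP K')) (grad_ract (gradP K')).
rewrite big_ord_recl suspension_pure contract00 expr1 scaleN1r.
(* The shift from [k] to [k + 1] costs one factor -1, which produces the overall minus sign. *)
under eq_bigr => k _ do
  rewrite suspension_pure contract_lift0 contract_lift lift0 exprS mulN1r scaleNr.
rewrite lift_max0 lift0_max.
under [X in ract _ _ (g (pure_tensor_power X))]eq_fun do rewrite lift_max_lift0.
rewrite !linearD !linear_sum /= !linearZ /=.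
under [in RHS]eq_bigr do rewrite !linearZ /= scalerN.
(* [subrr] cancels the Leibniz term [a_0 a_1 ⊗ ...] against the contraction at 0; their tails agree
   by computation. *)
by rewrite addrA [_ - _ - _]addrAC subrr sub0r exprS mulN1r scaleNr scalerN.
Qed.

(** Induction starts at 0, where the cocycle condition is exactly that [xi] commutes with the
    algebra. The linear map is built along with the cocycle property because [suspension] needs it
    at each stage. *)
Lemma iter_class_cocycle (nabla : forall K : hbimodule Abar, gradient delta K)
    n (K : hbimodule Abar) (xi : K) :
  (forall a : elt A, lact K a xi = ract K a xi) ->
  exists f : {linear tensor_power (elt A : lmodType R[i]) n ->
                     iter_gradient nabla n K},
    (forall a, f (pure_tensor_power a) = iter_class nabla xi a)
    /\ hochschild_cocycle f.
Proof.
move=> xiC; elim: n => [|n [f [fE fC]]].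
  have lin : linear (fun c : R[i]^o => c *: xi).
    by move=> c x y; rewrite scalerDl scalerA.
  pose f := HB.pack_for {linear R[i]^o -> K} (fun c : R[i]^o => c *: xi)
    (GRing.isLinear.Build _ _ _ _ _ lin).
  exists f; split=> [a|a]; first by rewrite /= scale1r.
  rewrite /hochschild_d big_ord0 addr0 /= !scale1r expr1 scaleN1r.
  (* In ['I_1] the first and last entries coincide, leaving [a xi - xi a]. *)
  by rewrite (ord1 ord_max) xiC subrr.
exists (suspension (nabla _) f); split=> a.
  by rewrite [LHS]suspension_pure fE.
by rewrite [LHS]hochschild_d_suspension fC linear0 linear0 oppr0.
Qed.

End GradientCocycle.

Theorem corollary3p12 (R : realType) (H : hilbert R)
    (M : set 'B(H)) (tau : 'B(H) -> R[i]) (Phi : R -> 'B(H) -> 'B(H))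
    (A : star_subalgebra H)
    (L2 : hbimodule (norm_closure (star_set A))) (gns : 'B(H) -> L2)
    (Delta : operator L2) (delta : elt A -> elt A)
    (nabla : forall K : hbimodule (norm_closure (star_set A)),
       gradient delta K)
    (n : nat) :
  von_neumann_algebra M -> finite_algebra M -> faithful_normal_trace M tau ->
  quantum_markov M tau Phi ->
  is_L2 M tau gns ->
  is_generator M Phi gns Delta ->
  standing_assumption M Phi gns Delta delta ->
  (1 <= n)%N ->
  exists f : {linear tensor_power (elt A : lmodType R[i]) n ->
                     iter_gradient nabla n L2},
    (forall a : 'I_n -> elt A,
       f (pure_tensor_power a) = iter_class nabla (gns 1) a)
    /\ hochschild_cocycle f.
Proof.
move=> vnM _ _ _ L2P _ _ _; apply: iter_class_cocycle => a.
have M1 := von_neumann_algebra1 vnM.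
have Aa : star_set A a := elt_valP a.
(* Both actions of [a] send [gns 1] to [gns a]. *)
rewrite (gns_lact L2P) ?(gns_ract L2P) ?mulr1 ?mul1r//.
all: exact: sub_norm_closure.
Qed.
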